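(* Let $A\in\mathbb{R}^{m\times n}$ have rank $m$, $b\in\mathbb{R}^m$, $c\in\mathbb{R}^n$, and suppose the linear program $\min\{c^Tx : Ax=b,\ x\ge 0\}$ has an optimal solution. Let $\delta$ and $\Delta$ be the smallest and the largest non-zero coordinate, respectively, occurring in any basic feasible solution of this linear program. Given an initial feasible basis, there exists a pivot rule that makes the simplex algorithm reach an optimal basis in at most $$\min\{n-m,\,m\}\,(n-m)\left\lceil \frac{(n-m)\Delta}{\delta}\ln\left(m\frac{\Delta}{\delta}\right)\right\rceil$$ simplex pivots (degenerate and non-degenerate pivots counted together).
   Context: Setting: $[n]=\{1,\dots,n\}$. For $B\subseteq[n]$, $A_B$ is the submatrix of $A$ of columns indexed by $B$, and $x_B$ the subvector of $x$ indexed by $B$. A basis is a set $B\subseteq[n]$ with $|B|=m$ and $A_B$ non-singular; put $N=[n]\setminus B$. Its basic solution is $x$ with $x_B=A_B^{-1}b$, $x_N=0$; $B$ and $x$ are feasible if $x_B\ge 0$. Let $\overline{A}=A_B^{-1}A_N$ (rows indexed by $B$, columns by $N$) and $\overline{c}_N^T=c_N^T-c_B^T\overline{A}$ (reduced costs). A feasible basis with $\overline{c}_N\ge 0$ is called optimal. Simplex pivot: from a feasible basis $B$ with basic solution $x$, choose an entering index $f\in N$ with $\overline{c}_{N,f}<0$, and a leaving index $i\in B$ minimizing $x_i/\overline{A}_{if}$ among all $i\in B$ with $\overline{A}_{if}>0$; replace $B$ by $(B\setminus\{i\})\cup\{f\}$. The pivot is degenerate if the attained minimum ratio is $0$, and non-degenerate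 otherwise. Pivot rule: a rule that selects the entering and the leaving index at each iteration of the simplex algorithm; it may use additional information (such as knowledge of an optimal solution, or a vector kept and updated from iteration to iteration). It is understood that $\delta,\Delta$ are defined, i.e. that some basic feasible solution has a non-zero coordinate (equivalently $b\neq 0$).
   Formalization: The case m = 1, n > 1, δ = Δ is excluded: there the logarithm is ln 1 = 0, so the bound is 0 and the claim fails for any non-optimal initial basis, e.g. A = (1 1), b = 1, c = (0,1), initial basis {2}. *)

(* Defs.v *)
From HB Require Import structures.
From mathcomp Require Import all_boot all_order all_algebra.
From mathcomp Require Import reals exp.
Set Implicit Arguments.
Unset Strict Implicit.
Unset Printing Implicit Defensive.
Import Order.TTheory GRing.Theory Num.Theory.
Local Open Scope ring_scope.

(* Index sets B are {set 'I_n}, enumerated increasingly by [enum B].  A vector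
   or matrix whose rows (or columns) are indexed by B is stored with row (or
   column) type 'I_m, in that order.  The definitions below are meaningful only
   when #|B| = m; otherwise [conform_mx] returns the junk value 0. *)

Section LinearProgram.
Variables (R : realType) (m n : nat).
Variables (A : 'M[R]_(m, n)) (b : 'cV[R]_m) (c : 'cV[R]_n).
Implicit Types (B : {set 'I_n}) (x : 'cV[R]_n).

Definition lp_feasible x : Prop :=
  A *m x = b /\ forall i, 0 <= x i 0.

Definition lp_value x : R := (c^T *m x) 0 0.

Definition lp_optimal x : Prop :=
  lp_feasible x /\ forall y, lp_feasible y -> lp_value x <= lp_value y.

(* A_B *)
Definition basis_mx B : 'M[R]_m :=
  conform_mx 0 (colsub (fun k : 'I_#|B| => enum_val k) A).

(* c_B *)
Definition basis_cost B : 'cV[R]_m :=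
  conform_mx 0 (rowsub (fun k : 'I_#|B| => enum_val k) c).

(* Row i of the result is the row of M attached to i when i \in B, and is zero
   when i \notin B ([index i (enum B)] is then #|B| = m and [insub] fails). *)
Definition spread_rows B p (M : 'M[R]_(m, p)) : 'M[R]_(n, p) :=
  \matrix_(i, j)
    if insub (index i (enum B)) is Some k then M k j else 0.

Definition is_basis B : bool :=
  (#|B| == m) && (basis_mx B \in unitmx).

Definition basic_solution B : 'cV[R]_n :=
  spread_rows B (invmx (basis_mx B) *m b).

(* Entry (i, f) with i \in B and f \notin B is the entry (i, f) of
   A_B^-1 A_N; the other entries are not used. *)
Definition tableau B : 'M[R]_n :=
  spread_rows B (invmx (basis_mx B) *m A).

(* Entry f \notin B is the reduced cost of f. *)
Definition reduced_cost B : 'rV[R]_n :=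
  c^T - (basis_cost B)^T *m (invmx (basis_mx B) *m A).

Definition feasible_basis B : bool :=
  is_basis B && [forall i in B, 0 <= basic_solution B i 0].

Definition optimal_basis B : bool :=
  feasible_basis B && [forall f, (f \notin B) ==> (0 <= reduced_cost B 0 f)].

Definition bfs_nonzero_coord (v : R) : Prop :=
  exists B i, [/\ feasible_basis B, basic_solution B i 0 = v & v != 0].

Definition is_min_coord (v : R) : Prop :=
  bfs_nonzero_coord v /\ forall w, bfs_nonzero_coord w -> v <= w.

Definition is_max_coord (v : R) : Prop :=
  bfs_nonzero_coord v /\ forall w, bfs_nonzero_coord w -> w <= v.

Definition ratio B (f i : 'I_n) : R :=
  basic_solution B i 0 / tableau B i f.

Definition is_pivot B (f i : 'I_n) : bool :=
  [&& f \notin B, reduced_cost B 0 f < 0, i \in B, 0 < tableau B i f &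
      [forall j in B, (0 < tableau B j f) ==> (ratio B f i <= ratio B f j)]].

(* The memory carries whatever additional information the rule uses; being
   chosen after A, b, c, the rule may also exploit, e.g., an optimal solution.
   It must return a legal pivot for every memory state and every non-optimal
   feasible basis, including those not met along the run. *)
Record pivot_rule := PivotRule {
  rule_memory : Type;
  rule_init : rule_memory;
  rule_enter : rule_memory -> {set 'I_n} -> 'I_n;
  rule_leave : rule_memory -> {set 'I_n} -> 'I_n;
  rule_update : rule_memory -> {set 'I_n} -> rule_memory;
  rule_legal : forall s B, feasible_basis B -> ~~ optimal_basis B ->
    is_pivot B (rule_enter s B) (rule_leave s B) }.

(* One iteration, with exactly one pivot unless the basis is optimal, in which
   case the algorithm has stopped. *)
Definition simplex_step (r : pivot_rule) (sB : rule_memory r * {set 'I_n}) :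
    rule_memory r * {set 'I_n} :=
  let: (s, B) := sB in
  if optimal_basis B then (s, B)
  else (rule_update s B, (B :\ rule_leave s B) :|: [set rule_enter s B]).

Definition simplex_basis (r : pivot_rule) (B0 : {set 'I_n}) (t : nat) :
    {set 'I_n} :=
  (iter t (@simplex_step r) (rule_init r, B0)).2.

End LinearProgram.

(* Main.v *)
Require Import Defs.
From mathcomp Require Import all_boot all_order all_algebra.
From mathcomp Require Import reals sequences exp.
From mathcomp Require Import ring lra.
Import Order.TTheory GRing.Theory Num.Theory.
Local Open Scope ring_scope.

(** Since the rule may carry any memory, it is enough to find a short sequence
    of legal pivots from [B0] to an optimal basis: [scripted_rule] turns a
    sequence into a rule.  Fix an optimal basis [Bs] with basic solution [xs].
    The sequence has two stages.

    Reaching the optimal value.  From a basis [B] with solution [x], keep a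
    direction [g], initially [xs - x], that is feasible at [x] and has negative
    cost.  Enter, among the nonbasic [f] with [g f != 0], one of least reduced
    cost.  If the pivot is degenerate, move [g] along the edge of [f] until it
    vanishes at some basic coordinate where [x] is zero, and let that coordinate
    leave: [g] stays feasible, its cost does not increase, its other nonbasic
    entries do not change, and it has lost one nonbasic nonzero entry.  Hence
    after at most [minn (n - m) m] pivots, one is nondegenerate; as [g f] is then
    still [xs f <= dmax], that pivot multiplies the gap to the optimal value by
    at most [1 - 1/K], where [K = (n - m) dmax / dmin] ([improve_along],
    [gap_phase]).  Now measure the gap with the reduced costs of [Bs]: the gap of
    [B] is the sum of [rc Bs j * x j].  Call [j] settled when
    [rc Bs j * dmin > gap]; then [x j] is zero for good.  When the gap falls by
    more than a factor [m dmax / dmin], one more of the [n - m] indices outside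
    [Bs] is settled ([unsettled_shrink]), and [q = ceil (K ln (m dmax / dmin))]
    nondegenerate pivots suffice for this.  While a single index is unsettled,
    only two vertices are possible, so one nondegenerate pivot ends this stage
    ([last_unsettled]); it takes at most [(n - m - 1) q + 1] of them in all.

    Reaching an optimal basis.  The current solution is now optimal, but its
    basis [B] may have negative reduced costs.  If [Bs] is any optimal basis of
    the same solution, there are a pivot on some [i] in [B] but not in [Bs] and
    another such optimal basis that contains the entering index together with
    the intersection of [B] and [Bs]; so [minn (n - m) m.-1] degenerate pivots
    suffice ([optimal_approach]).

    These last pivots fit into the bound because [q >= 2] if [m] and [n - m] are
    at least [2], and because there are none if [m = 1]; if [n - m = 1], a single
    pivot from a non-optimal basis is enough ([single_nonbasic_pivot]).

    Optimal bases, and their replacement in the last stage, come from a form of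
    the Farkas lemma that produces a basis ([dual_basis_or_ray]). *)

Set Implicit Arguments.
Unset Strict Implicit.
Unset Printing Implicit Defensive.

(** * Bases, tableaux and pivots without enumerations *)

Section BasisCalculus.
Variables (R : realType) (m n : nat).
Variables (A : 'M[R]_(m, n)) (b : 'cV[R]_m) (c : 'cV[R]_n).
Implicit Types (B F J : {set 'I_n}) (x z d g : 'cV[R]_n).

Lemma entry_addZ x (a : R) y (i : 'I_n) :
  (x + a *: y) i 0 = x i 0 + a * y i 0.
Proof. by rewrite !mxE. Qed.

Definition supported B z := forall i, i \notin B -> z i 0 = 0.

Definition basis_index B (hB : #|B| = m) (k : 'I_m) : 'I_n :=
  enum_val (cast_ord (esym hB) k).

Lemma conform_colsub p q (M : 'M[R]_(p, n)) B (hB : #|B| = q) :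
  conform_mx (0 : 'M_(p, q)) (colsub (fun k : 'I_#|B| => enum_val k) M)
  = \matrix_(i, k) M i (enum_val (cast_ord (esym hB) k)).
Proof.
case: q / hB; rewrite conform_mx_id; apply/matrixP => i k.
by rewrite !mxE cast_ord_id.
Qed.

Lemma basis_mxE B (hB : #|B| = m) i k :
  basis_mx A B i k = A i (basis_index hB k).
Proof. by rewrite /basis_mx (conform_colsub A hB) mxE. Qed.

Lemma basis_costE B (hB : #|B| = m) :
  (basis_cost m c B)^T = \matrix_(i, k) c (basis_index hB k) i.
Proof.
have -> : basis_cost m c B =
    (conform_mx (0 : 'rV_m) (colsub (fun k : 'I_#|B| => enum_val k) c^T))^T.
  rewrite trmx_conform trmx0; congr conform_mx.
  by apply/matrixP => i k; rewrite !mxE.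
rewrite trmxK (conform_colsub c^T hB).
by apply/matrixP => i k; rewrite !mxE.
Qed.

Lemma spread_rows_index B (hB : #|B| = m) p (M : 'M[R]_(m, p)) k j :
  spread_rows B M (basis_index hB k) j = M k j.
Proof.
rewrite mxE /basis_index.
have hk : (index (enum_val (cast_ord (esym hB) k)) (enum B) = k)%N.
  rewrite /enum_val index_uniq ?enum_uniq //.
  by rewrite -cardE ltn_ord.
rewrite hk insubT; first exact: ltn_ord.
by move=> h /=; congr (M _ j); apply: val_inj.
Qed.

Lemma spread_rows_out B (hB : #|B| = m) p (M : 'M[R]_(m, p)) i j :
  i \notin B -> spread_rows B M i j = 0.
Proof.
move=> hi; rewrite mxE insubF //.
have := memNindex (s := enum B) (x := i).
by rewrite mem_enum => /(_ hi) ->; rewrite -cardE hB ltnn.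
Qed.

Lemma sum_basis B (hB : #|B| = m) (h : 'I_n -> R) :
  (forall i, i \notin B -> h i = 0) ->
  \sum_i h i = \sum_(k < m) h (basis_index hB k).
Proof.
move=> h0; rewrite (bigID (mem B)) /= [X in _ + X]big1 ?addr0; last exact: h0.
rewrite big_enum_val /basis_index; case: m / hB.
by apply: eq_bigr => k _; rewrite cast_ord_id.
Qed.

Lemma mul_spread_rows B (hB : #|B| = m) p (M : 'M[R]_(m, p)) :
  A *m spread_rows B M = basis_mx A B *m M.
Proof.
apply/matrixP => i j; rewrite !mxE (sum_basis hB); last first.
  by move=> k hk; rewrite (spread_rows_out hB) ?mulr0.
by apply: eq_bigr => k _; rewrite (basis_mxE hB) (spread_rows_index hB).
Qed.

Lemma cost_spread_rows B (hB : #|B| = m) p (M : 'M[R]_(m, p)) :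
  c^T *m spread_rows B M = (basis_cost m c B)^T *m M.
Proof.
apply/matrixP => i j; rewrite (basis_costE hB) !mxE (sum_basis hB); last first.
  by move=> k hk; rewrite (spread_rows_out hB) ?mulr0.
by apply: eq_bigr => k _; rewrite (spread_rows_index hB) !mxE [i]ord1.
Qed.

Lemma supported_spread B (hB : #|B| = m) z :
  supported B z -> z = spread_rows B (\col_k z (basis_index hB k) 0).
Proof.
move=> hz; apply/colP => i; case: (boolP (i \in B)) => hi; last first.
  by rewrite hz // (spread_rows_out hB).
have [k ->] : exists k, i = basis_index hB k.
  exists (cast_ord hB (enum_rank_in hi i)).
  by rewrite /basis_index cast_ordK enum_rankK_in.
by rewrite spread_rows_index mxE.
Qed.

(** This form of the definition hides the enumeration of [B] behind
    [basis_mx].  From here on, facts about a basis come from the uniqueness of a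
    vector supported in [B] with a given image under [A] ([basis_inj]). *)
Lemma is_basisP B :
  reflect (#|B| = m /\ forall z, supported B z -> A *m z = 0 -> z = 0)
          (is_basis A B).
Proof.
apply: (iffP andP) => [[/eqP hB hU]|[hB hinj]].
  split=> // z /(supported_spread hB) ->.
  rewrite (mul_spread_rows hB); set g := \col_k _ => h0.
  have -> : g = 0 by rewrite -(mulKmx hU g) h0 mulmx0.
  by apply/colP => i; rewrite !mxE; case: insub => [k|]; rewrite ?mxE.
split; first exact/eqP.
rewrite -unitmx_tr -row_free_unit; apply: inj_row_free => v hv.
have hs : A *m spread_rows B v^T = 0.
  by rewrite (mul_spread_rows hB); apply: trmx_inj; rewrite trmx_mul trmxK hv trmx0.
have h0 := hinj _ (fun i => spread_rows_out hB _ _) hs.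
apply/rowP => k; have := spread_rows_index hB v^T k 0.
by rewrite h0 !mxE.
Qed.

Lemma basis_card B : is_basis A B -> #|B| = m.
Proof. by case/is_basisP. Qed.

Lemma basis_inj B z1 z2 : is_basis A B ->
  supported B z1 -> supported B z2 -> A *m z1 = A *m z2 -> z1 = z2.
Proof.
case/is_basisP=> _ hinj h1 h2 h12; apply/eqP; rewrite -subr_eq0; apply/eqP.
apply: hinj; last by rewrite mulmxBr h12 subrr.
by move=> i hi; rewrite !mxE h1 // h2 // subrr.
Qed.

Lemma basic_solution_eq B : is_basis A B -> A *m basic_solution A b B = b.
Proof.
by case/andP=> /eqP hB hU; rewrite (mul_spread_rows hB) mulKVmx.
Qed.

Lemma basic_solution_out B i : is_basis A B ->
  i \notin B -> basic_solution A b B i 0 = 0.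
Proof. by move/basis_card=> hB; apply: spread_rows_out. Qed.

Lemma basic_solution_uniq B z : is_basis A B ->
  supported B z -> A *m z = b -> z = basic_solution A b B.
Proof.
move=> hB hs hz; apply: (basis_inj hB) => //; last by rewrite basic_solution_eq.
by move=> i; apply: basic_solution_out.
Qed.

Lemma supported_tableau B z : is_basis A B -> supported B (tableau A B *m z).
Proof.
move/basis_card=> hB i hi; rewrite mxE big1 // => j _.
by rewrite (spread_rows_out hB) ?mul0r.
Qed.

Lemma mul_tableau B : is_basis A B -> A *m tableau A B = A.
Proof. by case/andP=> /eqP hB hU; rewrite (mul_spread_rows hB) mulKVmx. Qed.

Lemma tableau_id B z : is_basis A B -> supported B z -> tableau A B *m z = z.
Proof.
move=> hB hz; apply: (basis_inj hB) => //; first exact: supported_tableau.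
by rewrite mulmxA mul_tableau.
Qed.

Lemma tableau_ker B z : is_basis A B -> A *m z = 0 -> tableau A B *m z = 0.
Proof.
move=> hB hz; apply: (basis_inj hB); first exact: supported_tableau.
  by move=> i; rewrite mxE.
by rewrite mulmxA mul_tableau // hz mulmx0.
Qed.

Lemma reduced_costE B : is_basis A B ->
  reduced_cost A c B = c^T - c^T *m tableau A B.
Proof. by move/basis_card=> hB; rewrite (cost_spread_rows hB). Qed.

(** For the reduced costs of any basis, the cost of a difference of two
    solutions is read off nonbasic coordinates; this serves both for the current
    basis and as the dual certificate of an optimal one. *)
Lemma reduced_cost_ker B z : is_basis A B -> A *m z = 0 ->
  lp_value c z = \sum_j reduced_cost A c B 0 j * z j 0.
Proof.
move=> hB hz; rewrite /lp_value.
have -> : c^T *m z = reduced_cost A c B *m z.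
  by rewrite reduced_costE // mulmxBl -mulmxA tableau_ker // mulmx0 subr0.
by rewrite mxE.
Qed.

Lemma lp_valueD x y : lp_value c (x + y) = lp_value c x + lp_value c y.
Proof. by rewrite /lp_value mulmxDr mxE. Qed.

Lemma lp_valueZ (a : R) x : lp_value c (a *: x) = a * lp_value c x.
Proof. by rewrite /lp_value -scalemxAr mxE. Qed.

Lemma lp_valueB x y : lp_value c (x - y) = lp_value c x - lp_value c y.
Proof. by rewrite lp_valueD -scaleN1r lp_valueZ mulN1r. Qed.

(** The direction that raises the nonbasic coordinate [f] at unit speed while the
    basic coordinates compensate. *)
Definition edge B f : 'cV[R]_n :=
  delta_mx f 0 - tableau A B *m delta_mx f 0.

Lemma edgeE B f i : edge B f i 0 = (i == f)%:R - tableau A B i f.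
Proof. by rewrite /edge -colE !mxE andbT. Qed.

Lemma edge_ker B f : is_basis A B -> A *m edge B f = 0.
Proof. by move=> hB; rewrite mulmxBr mulmxA mul_tableau // subrr. Qed.

Lemma edge_cost B f : is_basis A B ->
  lp_value c (edge B f) = reduced_cost A c B 0 f.
Proof.
move=> hB; rewrite /lp_value mulmxBr mulmxA -mulmxBl -reduced_costE //.
by rewrite -colE mxE.
Qed.

Lemma tableau_out B i j : is_basis A B -> i \notin B -> tableau A B i j = 0.
Proof. by move/basis_card=> hB; apply: spread_rows_out. Qed.

Lemma tableau_basic B i j : is_basis A B -> j \in B ->
  tableau A B i j = (i == j)%:R.
Proof.
move=> hB hj.
have : tableau A B *m (delta_mx j 0 : 'cV_n) = delta_mx j 0.
  apply: tableau_id => // k hk; rewrite mxE andbT; case: eqP hk => // ->.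
  by rewrite hj.
by move/colP/(_ i); rewrite -colE !mxE andbT.
Qed.

Lemma reduced_cost_basic B i : is_basis A B -> i \in B ->
  reduced_cost A c B 0 i = 0.
Proof.
move=> hB hi; rewrite -edge_cost //.
suff -> : edge B i = 0 by rewrite -(scale0r 0) lp_valueZ mul0r.
by apply/colP => k; rewrite edgeE tableau_basic // subrr mxE.
Qed.

Definition exchange B f i := (B :\ i) :|: [set f].

Lemma in_exchange B f i k :
  (k \in exchange B f i) = ((k != i) && (k \in B)) || (k == f).
Proof. by rewrite !inE. Qed.

(** A kernel vector supported in the new set is a multiple of [edge B f], by
    uniqueness in [B]; its [i]-th coordinate is zero while that of the edge is
    not. *)
Lemma exchange_basis B f i : is_basis A B -> i \in B -> f \notin B ->
  tableau A B i f != 0 -> is_basis A (exchange B f i).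
Proof.
move=> hB hi hf hT; have hif : i != f by apply: contraNneq hf => <-.
apply/is_basisP; split=> [|z hz hAz].
  rewrite /exchange setUC cardsU1 !inE (negPf hf) andbF /=.
  by have := cardsD1 i B; rewrite hi (basis_card hB).
have hzf : z = z f 0 *: edge B f.
  apply/eqP; rewrite -subr_eq0; apply/eqP; apply: (basis_inj hB).
  - move=> k hk; rewrite -scaleNr entry_addZ edgeE tableau_out //.
    have [->|hkf] := eqVneq k f; first by rewrite subr0 mulr1 addrN.
    by rewrite hz ?in_exchange ?(negPf hk) ?andbF // subrr mulr0 addr0.
  - by move=> k _; rewrite mxE.
  - by rewrite mulmxBr -scalemxAr edge_ker // hAz scaler0 subr0 mulmx0.
have : z i 0 = 0 by apply: hz; rewrite in_exchange eqxx (negPf hif).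
rewrite {1}hzf mxE edgeE (negPf hif) sub0r => /eqP.
rewrite mulf_eq0 oppr_eq0 (negPf hT) orbF => /eqP h0.
by rewrite hzf h0 scale0r.
Qed.

Lemma exchange_solution B f i : is_basis A B -> i \in B -> f \notin B ->
  tableau A B i f != 0 ->
  basic_solution A b (exchange B f i) =
  basic_solution A b B + Defs.ratio A b B f i *: edge B f.
Proof.
move=> hB hi hf hT; have hif : i != f by apply: contraNneq hf => <-.
apply/esym/basic_solution_uniq; first exact: exchange_basis.
  move=> k; rewrite in_exchange negb_or negb_and negbK => /andP [/orP[/eqP ->|hk] hkf].
    by rewrite entry_addZ edgeE (negPf hif) sub0r mulrN divfK ?subrr.
  rewrite entry_addZ edgeE (negPf hkf) basic_solution_out //.
  by rewrite tableau_out // subr0 mulr0 addr0.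
by rewrite mulmxDr -scalemxAr edge_ker // scaler0 addr0 basic_solution_eq.
Qed.

Lemma feasible_basisP B :
  reflect (is_basis A B /\ forall i, 0 <= basic_solution A b B i 0)
          (feasible_basis A b B).
Proof.
apply: (iffP andP) => -[hB h]; split=> //; last by apply/forall_inP.
move=> i; case: (boolP (i \in B)) => hi; first exact: (forall_inP h).
by rewrite basic_solution_out.
Qed.

Lemma optimal_basisP B :
  reflect (feasible_basis A b B /\ forall f, 0 <= reduced_cost A c B 0 f)
          (optimal_basis A b c B).
Proof.
apply: (iffP andP) => -[hB h]; split=> //; last by apply/forallP => f; apply/implyP.
move=> f; case: (boolP (f \in B)) => hf; last exact: (implyP (forallP h f)).
by rewrite reduced_cost_basic //; case/andP: hB.
Qed.

Lemma pivot_feasible B f i : feasible_basis A b B -> is_pivot A b c B f i ->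
  feasible_basis A b (exchange B f i).
Proof.
case/feasible_basisP=> hB hx /and5P[hf hs hi hT /forall_inP hmin].
have hT0 := lt0r_neq0 hT.
apply/feasible_basisP; split=> [|k]; first exact: exchange_basis.
have hr : 0 <= Defs.ratio A b B f i by rewrite divr_ge0 // ltW.
rewrite exchange_solution // entry_addZ edgeE.
case: (boolP (k \in B)) => hk; last first.
  by rewrite tableau_out // subr0 addr_ge0 // mulr_ge0.
have -> : (k == f) = false by apply/eqP => hkf; rewrite hkf (negPf hf) in hk.
rewrite sub0r mulrN subr_ge0.
have [hTk|hTk] := ltP 0 (tableau A B k f).
  by rewrite -ler_pdivlMr // (implyP (hmin k hk)).
by apply: le_trans (hx k); rewrite mulr_ge0_le0.
Qed.

Lemma exchange_cost B f i : is_basis A B -> i \in B -> f \notin B ->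
  tableau A B i f != 0 ->
  lp_value c (basic_solution A b (exchange B f i)) =
  lp_value c (basic_solution A b B) + Defs.ratio A b B f i * reduced_cost A c B 0 f.
Proof.
by move=> *; rewrite exchange_solution // lp_valueD lp_valueZ edge_cost.
Qed.

End BasisCalculus.

(** * A Farkas lemma that returns a basis *)

Section Duality.
Variables (R : realType) (m n : nat).
Variables (A : 'M[R]_(m, n)) (b : 'cV[R]_m) (c : 'cV[R]_n).
Implicit Types (B F G J : {set 'I_n}) (x z d g : 'cV[R]_n) (f : 'I_n).

Lemma exchange_sub B G f i :
  B \subset G -> f \in G -> exchange B f i \subset G.
Proof.
move=> hBG hf; apply/subsetP => k; rewrite in_exchange.
by case/orP => [/andP[_ /(subsetP hBG)]|/eqP ->].
Qed.

Lemma sub_exchange F B f i :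
  F \subset B -> i \notin F -> F \subset exchange B f i.
Proof.
move=> hFB hi; apply/subsetP => k hk; rewrite in_exchange (subsetP hFB) // andbT.
by rewrite (_ : k != i) //; apply: contraNneq hi => <-.
Qed.

Definition dual_basis F J :=
  exists B, [/\ is_basis A B, F \subset B, B \subset F :|: J &
                forall j, j \in J -> 0 <= reduced_cost A c B 0 j].

Definition descent_ray G J :=
  exists d, [/\ A *m d = 0, supported G d,
                forall j, j \in J -> 0 <= d j 0 & lp_value c d < 0].

(** Columns of [F] are free, those of [J] are sign-constrained, all others are
    absent.  Induction on [J]: pick [e] in [J].  Deleting [e] gives a ray or a
    basis [B1] that can only fail at [e]; freeing [e] gives a basis or a ray [d]
    that can only fail at [e].  If both fail then [d e < 0], and the cost of [d]
    computed with the reduced costs of [B1] is positive, a contradiction.  The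
    rest of the proof deals with the cases in which deleting or freeing [e]
    leaves no basis. *)
Lemma dual_basis_or_ray F J : [disjoint F & J] ->
  (exists B, [/\ is_basis A B, F \subset B & B \subset F :|: J]) ->
  dual_basis F J \/ descent_ray (F :|: J) J.
Proof.
have [k] := ubnP #|J|; elim: k F J => // k IH F J hk hFJ [B0 [hB0 hFB0 hB0J]].
have [J0|[e he]] := set_0Vmem J.
  by left; exists B0; split=> // j; rewrite J0 inE.
have hcard : (#|J :\ e| < k)%N by move: hk; rewrite (cardsD1 e J) he.
have heF : e \notin F by move: hFJ; rewrite disjoint_sym => /disjointFr ->.
have hU : (e |: F) :|: (J :\ e) = F :|: J.
  by rewrite -setUA setUCA setD1K.
have hJe j : j \in J -> j != e -> j \in J :\ e by move=> h1 h2; rewrite !inE h2.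
have free_e : (exists B, [/\ is_basis A B, e |: F \subset B & B \subset F :|: J]) ->
  dual_basis F J \/ descent_ray (F :|: J) (J :\ e).
  case=> B hB; have hd : [disjoint e |: F & J :\ e].
    rewrite -setI_eq0; apply/eqP/setP => j; rewrite !inE.
    case: eqVneq => //= _; have [hj|] := boolP (j \in F) => //=.
    by rewrite (disjointFr hFJ hj).
  have := IH (e |: F) (J :\ e) hcard hd; rewrite /dual_basis hU => /(_ (ex_intro _ B hB)).
  case=> [[B1 [h1 h2 h3 h4]]|]; last by right.
  left; exists B1; split=> //; first exact: subset_trans (subsetUr _ _) h2.
  move=> j hj; have [->|hje] := eqVneq j e; last exact/h4/hJe.
  by rewrite reduced_cost_basic // (subsetP h2) // setU11.
have delete_e : (exists B, [/\ is_basis A B, F \subset B & B \subset F :|: (J :\ e)]) ->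
  dual_basis F J \/ descent_ray (F :|: J) J.
  move=> hB; have hd : [disjoint F & J :\ e].
    by apply: disjointWr hFJ; apply: subsetDl.
  have hsub : F :|: J :\ e \subset F :|: J by rewrite setUS // subsetDl.
  case: (IH F (J :\ e) hcard hd hB) => [[B1 [h1 h2 h3 h4]]|[d [h1 h2 h3 h4]]]; last first.
    right; exists d; split=> // [i hi|j hj].
      by apply: h2; apply: contra hi; apply: (subsetP hsub).
    have [->|hje] := eqVneq j e; last exact/h3/hJe.
    by rewrite h2 // !inE (negPf heF) eqxx.
  have heB : e \notin B1.
    by apply/negP => /(subsetP h3); rewrite !inE (negPf heF) eqxx.
  have hB1J := subset_trans h3 hsub.
  have [hse|hse] := leP 0 (reduced_cost A c B1 0 e).
    left; exists B1; split=> // j hj; have [->//|hje] := eqVneq j e.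
    exact/h4/hJe.
  have [/exists_inP [i hi hT]|] := boolP [exists i in B1 :\: F, tableau A B1 i e != 0].
    case/setDP: hi => hiB hiF.
    case: free_e => [||[d [g1 g2 g3 g4]]]; [|by left|].
      exists (exchange B1 e i); split; first exact: exchange_basis.
        by rewrite subUset (@sub_exchange F) // andbT sub1set in_exchange eqxx orbT.
      by rewrite exchange_sub // !inE he orbT.
    right; exists d; split=> // j hj; have [->|hje] := eqVneq j e; last exact/g3/hJe.
    have hs : 0 <= \sum_(j | j != e) reduced_cost A c B1 0 j * d j 0.
      apply: sumr_ge0 => k0 hk0; have [hkJ|hkJ] := boolP (k0 \in J).
        by rewrite mulr_ge0 ?h4 ?g3 // hJe.
      have [hkF|hkF] := boolP (k0 \in F).
        by rewrite reduced_cost_basic ?mul0r // (subsetP h2).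
      by rewrite g2 ?mulr0 // inE (negPf hkF).
    move: g4; rewrite (reduced_cost_ker c h1 g1) (bigD1 e) //= => g4.
    rewrite leNgt; apply/negP => hde.
    have : 0 < reduced_cost A c B1 0 e * d e 0 by rewrite nmulr_rgt0.
    lra.
  move=> hno; right; exists (edge A B1 e); split.
  - exact: edge_ker.
  - move=> i; rewrite !inE negb_or => /andP[hiF hiJ]; rewrite edgeE tableau_out //.
      by case: eqVneq hiJ => [->|_ _]; rewrite ?he ?subrr.
    by apply: contra hiJ => /(subsetP hB1J); rewrite inE (negPf hiF).
  - move=> j hj; rewrite edgeE; have hjF : j \notin F by rewrite (disjointFl hFJ hj).
    have -> : tableau A B1 j e = 0; last by rewrite subr0 ler0n.
    have [hjB|hjB] := boolP (j \in B1); last by rewrite tableau_out.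
    apply/eqP; move: hno; apply: contraR => hT; apply/exists_inP.
    by exists j; rewrite ?inE ?hjF ?hjB.
  - by rewrite edge_cost.
have [heB0|heB0] := boolP (e \in B0); last first.
  apply: delete_e; exists B0; split=> //; apply/subsetP => j hj.
  have := subsetP hB0J _ hj; rewrite !inE => /orP[->//|->].
  by rewrite (_ : j != e) ?orbT //; apply: contraNneq heB0 => <-.
case: free_e => [||[d [g1 g2 g3 g4]]]; [|by left|].
  by exists B0; rewrite subUset sub1set heB0 hFB0.
have [hde|hde] := leP 0 (d e 0).
  by right; exists d; split=> // j hj; have [->//|hje] := eqVneq j e; apply/g3/hJe.
(* As [d] is in the kernel and nonzero at the basic index [e], it is nonzero at
   some nonbasic [f] whose edge moves [e]: [e] can be exchanged for [f]. *)
have [f /andP[hfJ hfB] hT] :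
    exists2 f, (f \in J) && (f \notin B0) & tableau A B0 e f != 0.
  have := congr1 (fun z : 'cV_n => z e 0) (tableau_ker hB0 g1).
  rewrite mxE (bigD1 e) //= tableau_basic // eqxx mul1r mxE => hsum.
  apply/exists_inP; rewrite -[_ _ _]negbK negb_exists_in; apply/negP => /forall_inP hall.
  move: hsum; rewrite big1 ?addr0; first by move=> h; rewrite h ltxx in hde.
  move=> j hje; have [hjB|hjB] := boolP (j \in B0).
    by rewrite tableau_basic // eq_sym (negPf hje) mul0r.
  have [hjJ|hjJ] := boolP (j \in J).
    by have := hall j; rewrite hjJ hjB negbK => /(_ isT)/eqP ->; rewrite mul0r.
  rewrite g2 ?mulr0 // inE (negPf hjJ) orbF.
  by apply: contra hjB; apply: (subsetP hFB0).
apply: delete_e; exists (exchange B0 f e); split; first exact: exchange_basis.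
  exact: sub_exchange.
apply/subsetP => j; rewrite in_exchange !inE => /orP[/andP[hj /(subsetP hB0J)]|/eqP ->].
  by rewrite inE hj.
by rewrite hfJ (_ : f != e) ?orbT //; apply: contraNneq hfB => ->.
Qed.

(** Any point of the dual polyhedron, given by its slack vector [s], extends to a
    dual feasible basis through the constraints [F] that are tight there: on a
    ray for [F], the sum of [s j * d j] has no negative term. *)
Lemma dual_basis_extend F (s : 'I_n -> R) :
  (exists2 B, is_basis A B & F \subset B) ->
  (forall d, A *m d = 0 -> lp_value c d = \sum_j s j * d j 0) ->
  (forall j, 0 <= s j) -> (forall j, j \in F -> s j = 0) ->
  exists B, [/\ is_basis A B, F \subset B & forall j, 0 <= reduced_cost A c B 0 j].
Proof.
move=> [B0 hB0 hF] hs hs0 hsF.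
case: (@dual_basis_or_ray F (~: F)).
- by rewrite -setI_eq0 setICr.
- by exists B0; rewrite setUCr subsetT.
- case=> B [h1 h2 _ h4]; exists B; split=> // j.
  have [hj|hj] := boolP (j \in F); last by rewrite h4 // inE.
  by rewrite reduced_cost_basic // (subsetP h2).
case=> d [h1 _ h3]; rewrite hs // ltNge sumr_ge0 // => j _.
have [/hsF ->|hj] := boolP (j \in F); first by rewrite mul0r.
by rewrite mulr_ge0 // h3 // inE.
Qed.
End Duality.

(** * Escaping degeneracy along a feasible direction *)

Section Pivoting.
Variables (R : realType) (m n : nat).
Variables (A : 'M[R]_(m, n)) (b : 'cV[R]_m) (c : 'cV[R]_n).
Implicit Types (B F J : {set 'I_n}) (x z d g : 'cV[R]_n) (f : 'I_n).
Local Notation x_ B := (basic_solution A b B).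
Local Notation cost := (lp_value c).
Local Notation T := (tableau A).
Local Notation rc := (reduced_cost A c).

Fixpoint legal_run B (w : seq ('I_n * 'I_n)) B' : bool :=
  if w is (f, i) :: w' then
    is_pivot A b c B f i && legal_run (exchange B f i) w' B'
  else B == B'.

Definition reach B k B' := exists2 w, (size w <= k)%N & legal_run B w B'.

Lemma reach_refl B k : reach B k B.
Proof. by exists [::] => /=. Qed.

Lemma reach_step B f i k B' :
  is_pivot A b c B f i -> reach (exchange B f i) k B' -> reach B k.+1 B'.
Proof. by move=> hp [w hw hr]; exists ((f, i) :: w) => //=; rewrite hp. Qed.

Lemma reach_weaken B k l B' : (k <= l)%N -> reach B k B' -> reach B l B'.
Proof. by move=> hkl [w hw hr]; exists w => //; apply: leq_trans hkl. Qed.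

Lemma reach_trans B k B1 l B2 :
  reach B k B1 -> reach B1 l B2 -> reach B (k + l) B2.
Proof.
case=> w hw hr [v hv hs]; exists (w ++ v); first by rewrite size_cat leq_add.
elim: w B {hw} hr => [|[f i] w IH] B /=; first by move/eqP->.
by case/andP=> -> /IH.
Qed.

Lemma reach_feasible B k B' :
  feasible_basis A b B -> reach B k B' -> feasible_basis A b B'.
Proof.
move=> hB [w _]; elim: w B hB => [|[f i] w IH] B hB /=; first by move/eqP<-.
by case/andP=> /(pivot_feasible hB) /IH.
Qed.

Definition no_descent_ray :=
  forall d, A *m d = 0 -> (forall i, 0 <= d i 0) -> 0 <= cost d.

Lemma optimal_no_ray : (exists x, lp_optimal A b c x) -> no_descent_ray.
Proof.
case=> x [[hx hx0] hopt] d hd hd0; have := hopt (x + 1 *: d).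
rewrite lp_valueD lp_valueZ mul1r lerDl; apply; split.
  by rewrite mulmxDr -scalemxAr hd scaler0 addr0.
by move=> i; rewrite entry_addZ mul1r addr_ge0.
Qed.

Hypothesis no_ray : no_descent_ray.

Lemma entering_nonbasic B f : is_basis A B -> rc B 0 f < 0 -> f \notin B.
Proof. by move=> hB; apply: contraTN => hf; rewrite reduced_cost_basic ?ltxx. Qed.

Lemma ratio_test B f : feasible_basis A b B -> rc B 0 f < 0 ->
  exists i, is_pivot A b c B f i.
Proof.
case/feasible_basisP=> hB hx hs; have hf := entering_nonbasic hB hs.
have [i0 hi0 hT0] : exists2 i, i \in B & 0 < T B i f.
  apply/exists_inP; rewrite -[_ _ _]negbK negb_exists_in; apply/negP => /forall_inP hno.
  have := no_ray (edge_ker f hB); rewrite edge_cost // => h.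
  have : 0 <= rc B 0 f; last by rewrite leNgt hs.
  apply: h => i; rewrite edgeE subr_ge0.
  have [hi|hi] := boolP (i \in B); last by rewrite tableau_out // ler0n.
  by apply: (@le_trans _ _ 0); rewrite ?ler0n // leNgt hno.
pose P i := (i \in B) && (0 < T B i f).
have hP0 : P i0 by rewrite /P hi0.
case: (arg_minP (Defs.ratio A b B f) hP0) => i /andP[hi hT] hmin.
exists i; rewrite /is_pivot hf hs hi hT /=; apply/forall_inP => j hj.
by apply/implyP => hTj; apply: hmin; rewrite /P hj.
Qed.

(** At ratio [0] every blocking row with a zero basic coordinate may leave; this
    freedom is what the two stages of the run exploit. *)
Lemma degenerate_pivot B f i : feasible_basis A b B -> rc B 0 f < 0 ->
  i \in B -> 0 < T B i f -> x_ B i 0 = 0 -> is_pivot A b c B f i.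
Proof.
case/feasible_basisP=> hB hx hs hi hT hx0.
rewrite /is_pivot (entering_nonbasic hB hs) hs hi hT /=.
apply/forall_inP => j hj; apply/implyP => hTj.
by rewrite /Defs.ratio hx0 mul0r divr_ge0 // ltW.
Qed.

Lemma degenerate_solution B f i : is_pivot A b c B f i -> is_basis A B ->
  x_ B i 0 = 0 -> x_ (exchange B f i) = x_ B.
Proof.
case/and5P=> hf _ hi hT _ hB hx0.
rewrite exchange_solution ?(lt0r_neq0 hT) //.
by rewrite /Defs.ratio hx0 mul0r scale0r addr0.
Qed.

Definition nonbasic_supp B z := [set f | (f \notin B) && (z f 0 != 0)].

Lemma in_nonbasic_supp B z f :
  (f \in nonbasic_supp B z) = (f \notin B) && (z f 0 != 0).
Proof. by rewrite inE. Qed.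

Lemma cost_nonbasic B z : is_basis A B -> A *m z = 0 ->
  cost z = \sum_(j in nonbasic_supp B z) rc B 0 j * z j 0.
Proof.
move=> hB hz; rewrite (reduced_cost_ker c hB hz) (bigID (mem (nonbasic_supp B z))) /=.
rewrite [X in _ + X]big1 ?addr0 // => j.
rewrite in_nonbasic_supp negb_and !negbK => /orP[hj|/eqP ->]; last by rewrite mulr0.
by rewrite reduced_cost_basic ?mul0r.
Qed.

(** The hypothesis on [i] says that [g] is a feasible direction at the basic
    solution of [B].  A degenerate pivot replaces [g] by [g + th *: edge A B f],
    where [th] is the largest step that keeps [g] feasible; the leaving index is
    the coordinate that stops it, so the nonbasic support of [g] loses [f] and
    gains nothing.  The estimate is the one for the final nondegenerate pivot,
    whose step is at least [delta]: [f] minimizes the reduced cost over at most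
    [p] indices where [g] is at most [D], so [- cost g] is at most
    [p * D * - rc B f]. *)
Lemma improve_along (delta D : R) (p k : nat) B g :
  (forall B1 i, feasible_basis A b B1 -> x_ B1 i 0 != 0 -> delta <= x_ B1 i 0) ->
  0 <= delta -> (k <= p)%N -> feasible_basis A b B ->
  A *m g = 0 -> (forall i, x_ B i 0 = 0 -> 0 <= g i 0) ->
  (forall f, f \notin B -> g f 0 <= D) -> cost g < 0 ->
  (#|nonbasic_supp B g| <= k)%N ->
  exists2 B', reach B k B' &
    delta * - cost g <= p%:R * D * (cost (x_ B) - cost (x_ B')).
Proof.
move=> hdelta hdelta0; elim: k B g => [|k IH] B g hkp hfB hg hg0 hD hcg hS.
  have [hB _] := feasible_basisP _ _ _ hfB.
  move: hcg; rewrite (cost_nonbasic hB hg) big1 ?ltxx // => j.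
  by move: hS; rewrite leqn0 cards_eq0 => /eqP ->; rewrite inE.
have [hB hx] := feasible_basisP _ _ _ hfB.
have hcost := cost_nonbasic hB hg.
have inS := in_nonbasic_supp B g; set S := nonbasic_supp B g in hS hcost inS.
have hgS j : j \in S -> 0 <= g j 0.
  by rewrite inS => /andP[hj _]; apply: hg0; rewrite basic_solution_out.
have [f0 hf0] : exists f0, f0 \in S.
  apply/set0Pn; apply: contraTneq hcg => hS0.
  by rewrite hcost big1 ?ltxx // => j; rewrite hS0 inE.
case: (arg_minP (rc B 0) hf0) => f hfS hmin.
have [hfB' hgf] : f \notin B /\ g f 0 != 0 by apply/andP; rewrite -inS.
have hsf : rc B 0 f < 0.
  rewrite ltNge; apply: contraTN hcg => hs0; rewrite -leNgt hcost.
  apply: sumr_ge0 => j hj.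
  by rewrite mulr_ge0 ?hgS // (le_trans hs0) // hmin.
have hD0 : 0 <= D by apply: le_trans (hD f hfB'); apply: hgS.
have hbound : - cost g <= p%:R * D * - rc B 0 f.
  rewrite hcost -sumrN -mulrA; apply: (@le_trans _ _ (\sum_(j in S) (D * - rc B 0 f))).
    apply: ler_sum => j hj; rewrite -mulNr mulrC.
    apply: (@le_trans _ _ (g j 0 * - rc B 0 f)).
      by rewrite ler_wpM2l ?hgS // lerN2 hmin.
    by rewrite ler_wpM2r ?oppr_ge0 ?(ltW hsf) // hD //; move: hj; rewrite inS => /andP[].
  rewrite sumr_const -[X in X <= _]mulr_natl ler_wpM2r ?mulr_ge0 ?oppr_ge0 ?(ltW hsf) //.
  by rewrite ler_nat (leq_trans hS).
(* the basic coordinates that make a pivot on [f] degenerate *)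
pose Z i := [&& i \in B, 0 < T B i f & x_ B i 0 == 0].
case: (pickP Z) => [i0 hi0|hZ]; last first.
  have [i hpiv] := ratio_test hfB hsf; exists (exchange B f i).
    exact: reach_step hpiv (reach_refl _ _).
  case/and5P: (hpiv) => _ _ hi hT _.
  have hxi : x_ B i 0 != 0 by move: (hZ i); rewrite /Z hi hT /= => /negbT.
  have hTn := lt0r_neq0 hT.
  have hr : 0 < Defs.ratio A b B f i by rewrite divr_gt0 // lt0r hxi hx.
  have hxf : x_ (exchange B f i) f 0 = Defs.ratio A b B f i.
    rewrite exchange_solution // entry_addZ edgeE eqxx tableau_out //.
    by rewrite basic_solution_out // add0r subr0 mulr1.
  have hdr : delta <= Defs.ratio A b B f i.
    by rewrite -hxf hdelta ?(pivot_feasible hfB hpiv) // hxf gt_eqF.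
  rewrite exchange_cost // opprD addNKr.
  apply: (@le_trans _ _ (Defs.ratio A b B f i * - cost g)).
    by rewrite ler_wpM2r // oppr_ge0 ltW.
  by rewrite -mulrN mulrCA ler_wpM2l // ltW.
case: (arg_minP (fun i => g i 0 / T B i f) hi0) => i /and3P[hi hT /eqP hxi] hgmin.
have hpiv := degenerate_pivot hfB hsf hi hT hxi.
have hTn := lt0r_neq0 hT.
have hif : i != f by apply: contraNneq hfB' => <-.
have hx' := degenerate_solution hpiv hB hxi.
set th := g i 0 / T B i f in hgmin.
have hth : 0 <= th by rewrite divr_ge0 ?(ltW hT) // hg0.
have [||||j|||B' hreach hB'] := IH (exchange B f i) (g + th *: edge A B f).
- exact: ltnW.
- exact: pivot_feasible hfB hpiv.
- by rewrite mulmxDr -scalemxAr edge_ker // hg scaler0 addr0.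
- rewrite hx' => j hxj; rewrite entry_addZ edgeE.
  have [hj|hj] := boolP (j \in B); last first.
    by rewrite tableau_out // subr0 addr_ge0 ?hg0 // mulr_ge0.
  have -> : (j == f) = false by apply/negbTE; apply: contraNneq hfB' => <-.
  rewrite sub0r mulrN subr_ge0; have [hTj|hTj] := ltP 0 (T B j f).
    by rewrite -ler_pdivlMr // hgmin // /Z hj hTj hxj eqxx.
  by apply: (@le_trans _ _ 0); rewrite ?hg0 ?mulr_ge0_le0.
- rewrite in_exchange negb_or negb_and negbK => /andP[hj hjf].
  rewrite entry_addZ edgeE (negPf hjf) sub0r; case/orP: hj => [/eqP ->|hj].
    by rewrite mulrN divfK // subrr.
  by rewrite tableau_out // oppr0 mulr0 addr0 hD.
- rewrite lp_valueD lp_valueZ edge_cost // -[X in _ < X]addr0 ltr_leD //.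
  by rewrite mulr_ge0_le0 // ltW.
- have /subset_leq_card :
      nonbasic_supp (exchange B f i) (g + th *: edge A B f) \subset S :\ f.
    apply/subsetP => j; rewrite in_setD1 inS in_nonbasic_supp in_exchange.
    rewrite negb_or negb_and negbK entry_addZ edgeE.
    case/andP=> /andP[hj hjf]; rewrite hjf (negPf hjf) sub0r.
    case/orP: hj => [/eqP ->|hj]; first by rewrite mulrN divfK // subrr eqxx.
    by rewrite tableau_out // oppr0 mulr0 addr0 hj.
  by move/leq_trans; apply; move: hS; rewrite (cardsD1 f S) (hfS : f \in S).
exists B'; first exact: reach_step hpiv hreach.
move: hB'; rewrite hx'; apply: le_trans.
rewrite ler_wpM2l // lerN2 lp_valueD lp_valueZ edge_cost // -[X in _ <= X]addr0.
by rewrite lerD2l mulr_ge0_le0 // ltW.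
Qed.
End Pivoting.

(** * From an optimal solution to an optimal basis *)

Section Endgame.
Variables (R : realType) (m n : nat).
Variables (A : 'M[R]_(m, n)) (b : 'cV[R]_m) (c : 'cV[R]_n).
Implicit Types (B F J : {set 'I_n}) (x z d g : 'cV[R]_n) (f : 'I_n).
Local Notation x_ B := (basic_solution A b B).
Local Notation cost := (lp_value c).
Local Notation T := (tableau A).
Local Notation rc := (reduced_cost A c).

Definition nonzero_coords z := [set i | z i 0 != 0].

Lemma nonzero_coords_basis B : is_basis A B -> nonzero_coords (x_ B) \subset B.
Proof.
move=> hB; apply/subsetP => i; rewrite inE; apply: contraR => hi.
by rewrite basic_solution_out.
Qed.

Lemma optimal_of_nonzero_coords B B2 : feasible_basis A b B -> is_basis A B2 ->
  nonzero_coords (x_ B) \subset B2 -> (forall j, 0 <= rc B2 0 j) ->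
  optimal_basis A b c B2 /\ x_ B2 = x_ B.
Proof.
move=> /feasible_basisP [hB hx] hB2 hF hrc.
have hxx : x_ B2 = x_ B.
  apply/esym/basic_solution_uniq => //; last by rewrite basic_solution_eq.
  move=> i hi; apply/eqP; apply: contraR hi => hi.
  by apply: (subsetP hF); rewrite inE.
split=> //; apply/optimal_basisP; split=> //.
by apply/feasible_basisP; split=> // i; rewrite hxx.
Qed.

(** Move the slack vector from that of [Bs] towards that of [B], and stop at the
    last dual feasible point [s].  There a constraint [f] violated by [B] becomes
    tight, and those of [B :&: Bs] still are, so some optimal basis [B2] contains
    them all.  Entering [f] and dropping some [i \notin Bs] brings [B] closer to
    [B2] than it was to [Bs]; the pivot is degenerate because [x_ B = x_ Bs] is
    zero at [i]. *)
Lemma optimal_approach k B Bs : feasible_basis A b B -> optimal_basis A b c Bs ->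
  x_ Bs = x_ B -> (#|B :\: Bs| <= k)%N ->
  exists2 B', reach A b c B k B' & optimal_basis A b c B'.
Proof.
elim: k B Bs => [|k IH] B Bs hfB hBs hxx hk.
all: have [/feasible_basisP [hbs hxs] hss] := optimal_basisP _ _ _ _ hBs.
all: have [hB hx] := feasible_basisP _ _ _ hfB.
  exists B; first exact: reach_refl.
  suff -> : B = Bs by [].
  apply/eqP; rewrite eqEcard (basis_card hB) (basis_card hbs) leqnn andbT.
  by rewrite -setD_eq0 -cards_eq0 -leqn0.
have [hopt|hnopt] := boolP (optimal_basis A b c B).
  by exists B => //; apply: reach_refl.
have [f0 hf0] : exists f0, rc B 0 f0 < 0.
  apply/existsP; apply: contraR hnopt; rewrite negb_exists => /forallP hno.
  apply/optimal_basisP; split=> // f; rewrite leNgt; exact: hno.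
pose t f := rc Bs 0 f / (rc Bs 0 f - rc B 0 f).
case: (@arg_minP _ _ _ f0 (fun f => rc B 0 f < 0) t hf0) => f hf hmin.
have hpos j : rc B 0 j < 0 -> 0 < rc Bs 0 j - rc B 0 j by move: (hss j); lra.
have ht0 : 0 <= t f by rewrite divr_ge0 // ltW // hpos.
have ht1 : t f <= 1 by rewrite ler_pdivrMr ?hpos // mul1r; move: hf; lra.
pose s j := (1 - t f) * rc Bs 0 j + t f * rc B 0 j.
have hs0 j : 0 <= s j.
  have [hj|hj] := leP 0 (rc B 0 j).
    by rewrite addr_ge0 // mulr_ge0 // subr_ge0.
  have := hmin j hj; rewrite ler_pdivlMr ?hpos // /s; lra.
have hsf : s f = 0.
  have : t f * (rc Bs 0 f - rc B 0 f) = rc Bs 0 f by rewrite divfK // gt_eqF ?hpos.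
  rewrite /s; lra.
(* otherwise the edge of [f] would have nonnegative cost by the reduced costs
   of [Bs] *)
have [i /setDP[hi hibs] hT] : exists2 i, i \in B :\: Bs & 0 < T B i f.
  apply/exists_inP; rewrite -[_ _ _]negbK negb_exists_in; apply/negP => /forall_inP hno.
  have := reduced_cost_ker c hbs (edge_ker f hB); rewrite edge_cost // => hsum.
  move: hf; rewrite hsum ltNge sumr_ge0 // => j _.
  have [hj|hj] := boolP (j \in Bs); first by rewrite reduced_cost_basic ?mul0r.
  rewrite mulr_ge0 // edgeE subr_ge0.
  apply: (@le_trans _ _ 0); last by rewrite ler0n.
  have [hjB|hjB] := boolP (j \in B); last by rewrite tableau_out.
  by rewrite leNgt hno // inE hj.
have hxi : x_ B i 0 = 0 by rewrite -hxx basic_solution_out.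
have hpiv := degenerate_pivot hfB hf hi hT hxi.
have hx1 := degenerate_solution hpiv hB hxi.
have hfB1 := pivot_feasible hfB hpiv.
have [hB1 _] := feasible_basisP _ _ _ hfB1.
have [||||B2 [hB2 hF2 hrc2]] := @dual_basis_extend R m n A c (f |: (B :&: Bs)) s.
- exists (exchange B f i) => //; apply/subsetP => j; rewrite in_exchange !inE.
  case/orP => [->|/andP[hj hj']]; rewrite ?orbT // hj andbT.
  by rewrite (_ : j != i) //; apply: contraNneq hibs => <-.
- move=> d hd; have e1 := reduced_cost_ker c hB hd; have e2 := reduced_cost_ker c hbs hd.
  transitivity ((1 - t f) * cost d + t f * cost d); first by ring.
  rewrite {1}e2 e1 !mulr_sumr -big_split /=; apply: eq_bigr => j _.
  by rewrite /s; ring.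
- exact: hs0.
- move=> j; rewrite !inE => /orP[/eqP -> //|/andP[hj hj']].
  by rewrite /s !reduced_cost_basic // !mulr0 addr0.
have hsup : nonzero_coords (x_ (exchange B f i)) \subset B2.
  apply: subset_trans hF2; rewrite hx1; apply/subsetP => j hj.
  rewrite !inE (subsetP (nonzero_coords_basis hB)) //=.
  by rewrite (subsetP (nonzero_coords_basis hbs)) ?orbT // hxx.
have [hopt2 hx2] := optimal_of_nonzero_coords hfB1 hB2 hsup hrc2.
have [|B' hr hB'] := IH _ _ hfB1 hopt2 hx2.
  rewrite -ltnS; apply: leq_trans hk; apply/proper_card/properP; split; last first.
    exists i; first by rewrite inE hibs.
    rewrite in_setD in_exchange eqxx /= negb_and orbC; apply/orP; left.
    by apply: contraNneq (entering_nonbasic hB hf) => <-.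
  apply/subsetP => j; rewrite in_setD in_exchange => /andP[hj hj'].
  have hjf : j != f.
    by apply: contraNneq hj => ->; apply: (subsetP hF2); rewrite !inE eqxx.
  move: hj'; rewrite (negPf hjf) orbF => /andP[_ hjB]; rewrite inE hjB andbT.
  by apply: contra hj => hjs; apply: (subsetP hF2); rewrite !inE hjB hjs orbT.
by exists B' => //; apply: reach_step hpiv hr.
Qed.

(** With one nonbasic index, the reverse of an improving edge is the only edge
    at the new basis. *)
Lemma single_nonbasic_pivot B f i : (n <= m.+1)%N -> feasible_basis A b B ->
  is_pivot A b c B f i -> optimal_basis A b c (exchange B f i).
Proof.
move=> hnm hfB hpiv; have hfB1 := pivot_feasible hfB hpiv.
apply/optimal_basisP; split=> // k.
have [hB _] := feasible_basisP _ _ _ hfB.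
have [hB1 _] := feasible_basisP _ _ _ hfB1.
case/and5P: hpiv => hf hs hi hT _.
have [hk|hk] := boolP (k \in exchange B f i); first by rewrite reduced_cost_basic.
have hif : i != f by apply: contraNneq hf => <-.
have hi1 : i \notin exchange B f i by rewrite in_exchange eqxx.
have honly j : j \notin exchange B f i -> j = i.
  move=> hj; apply/eqP/negPn/negP => hji.
  have : (#|[set j; i]| <= #|~: exchange B f i|)%N.
    by apply/subset_leq_card/subsetP => l; rewrite !inE -in_exchange => /orP[]/eqP->.
  rewrite cards2 hji cardsCs setCK card_ord (basis_card hB1) => h.
  by have := leq_trans h (leq_sub2r m hnm); rewrite subSnn.
rewrite (honly k hk); have := reduced_cost_ker c hB1 (edge_ker f hB).
rewrite edge_cost // (bigD1 i) //= big1 ?addr0 => [|j hj]; last first.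
  by rewrite reduced_cost_basic ?mul0r //; apply: contraNT hj => /honly ->.
rewrite edgeE (negPf hif) sub0r mulrN => hsum.
rewrite leNgt; apply/negP => hneg.
have : reduced_cost A c (exchange B f i) 0 i * T B i f < 0 by rewrite nmulr_rlt0.
lra.
Qed.

End Endgame.

(** * Geometric decrease of the gap to the optimal value *)

Section Descent.
Variables (R : realType) (m n : nat).
Variables (A : 'M[R]_(m, n)) (b : 'cV[R]_m) (c : 'cV[R]_n).
Implicit Types (B F J : {set 'I_n}) (x z d g : 'cV[R]_n) (f : 'I_n).
Local Notation x_ B := (basic_solution A b B).
Local Notation cost := (lp_value c).
Local Notation T := (tableau A).
Local Notation rc := (reduced_cost A c).
Local Notation feas := (feasible_basis A b).
Local Notation reach := (reach A b c).

Variables (dmin dmax : R).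
Hypothesis no_ray : no_descent_ray A c.
Hypothesis dmin_gt0 : 0 < dmin.
Hypothesis dmin_le : forall B i, feas B -> x_ B i 0 != 0 -> dmin <= x_ B i 0.
Hypothesis le_dmax : forall B i, feas B -> x_ B i 0 <= dmax.

(** At a feasible basis of least cost, either the nonzero coordinates of its
    solution extend to an optimal basis, or there is a feasible direction of
    negative cost and [improve_along] leads to a cheaper basis. *)
Lemma exists_optimal_basis B0 : feas B0 -> exists B, optimal_basis A b c B.
Proof.
move=> hB0; case: (@arg_minP _ _ _ B0 feas (fun B => cost (x_ B)) hB0) => B hfB hmin.
have [hB hx] := feasible_basisP _ _ _ hfB; pose F := nonzero_coords (x_ B).
case: (@dual_basis_or_ray R m n A c F (~: F)).
- by rewrite -setI_eq0 setICr.
- by exists B; rewrite setUCr subsetT nonzero_coords_basis.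
- case=> B1 [hB1 hF _ h1]; exists B1.
  apply: (proj1 (optimal_of_nonzero_coords hfB hB1 hF _)) => j.
  have [hj|hj] := boolP (j \in F); last by rewrite h1 // inE.
  by rewrite reduced_cost_basic // (subsetP hF).
case=> d [hd _ hdF hcd]; pose D := \sum_i `|d i 0|.
have [||||||B' hr] := improve_along (D := D) (p := n) (k := n) no_ray dmin_le _ _ hfB hd.
- exact: ltW.
- by [].
- by move=> i hi; rewrite hdF // !inE hi eqxx.
- move=> f _; rewrite /D (bigD1 f) //= (le_trans (ler_norm _)) // lerDl.
  by apply: sumr_ge0 => j _; apply: normr_ge0.
- exact: hcd.
- by rewrite -[leqRHS]card_ord max_card.
have hpos : 0 < dmin * - cost d by rewrite mulr_gt0 // oppr_gt0.
move=> h; have := lt_le_trans hpos h; rewrite ltNge mulr_ge0_le0 //.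
  by rewrite mulr_ge0 ?ler0n // sumr_ge0.
by rewrite subr_le0 hmin // (reach_feasible hfB hr).
Qed.

Variable Bs : {set 'I_n}.
Hypothesis hopt : optimal_basis A b c Bs.

Let hfs : feas Bs. Proof. by case/optimal_basisP: hopt. Qed.
Let hbs : is_basis A Bs. Proof. by case/feasible_basisP: hfs. Qed.
Let hss j : 0 <= rc Bs 0 j. Proof. by case/optimal_basisP: hopt. Qed.
Let hxs j : 0 <= x_ Bs j 0. Proof. by case/feasible_basisP: hfs. Qed.

Definition gap B := cost (x_ B) - cost (x_ Bs).

Lemma gapE B : feas B -> gap B = \sum_j rc Bs 0 j * x_ B j 0.
Proof.
case/feasible_basisP=> hB _; rewrite /gap -lp_valueB (reduced_cost_ker c hbs); last first.
  by rewrite mulmxBr !basic_solution_eq ?subrr.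
apply: eq_bigr => j _; rewrite -scaleN1r entry_addZ mulN1r.
have [hj|hj] := boolP (j \in Bs); first by rewrite reduced_cost_basic ?mul0r.
by rewrite [x_ Bs j 0]basic_solution_out // subr0.
Qed.

Lemma gap_term_ge0 B j : feas B -> 0 <= rc Bs 0 j * x_ B j 0.
Proof. by case/feasible_basisP=> _ hx; rewrite mulr_ge0. Qed.

Lemma gap_ge0 B : feas B -> 0 <= gap B.
Proof. by move=> hB; rewrite gapE // sumr_ge0 // => j _; apply: gap_term_ge0. Qed.

Lemma gap_term B j : feas B -> rc Bs 0 j * x_ B j 0 <= gap B.
Proof.
move=> hB; rewrite gapE // (bigD1 j) //= lerDl sumr_ge0 // => k _.
exact: gap_term_ge0.
Qed.

Hypothesis dmax_gt0 : 0 < dmax.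

Let p := minn (n - m) m.
Let K := (n - m)%N%:R * dmax / dmin.

(** The direction is [x_ Bs - x_ B].  Its nonbasic support lies in [Bs] and
    outside [B], which gives both bounds on the number of pivots. *)
Lemma gap_phase B : (0 < n - m)%N -> feas B -> 0 < gap B ->
  exists2 B', reach B p B' & gap B' <= (1 - K^-1) * gap B.
Proof.
move=> hnm hfB hgap; have [hB hx] := feasible_basisP _ _ _ hfB.
have hcg : cost (x_ Bs - x_ B) = - gap B by rewrite lp_valueB /gap opprB.
have hg i : (x_ Bs - x_ B) i 0 = x_ Bs i 0 - x_ B i 0.
  by rewrite -scaleN1r entry_addZ mulN1r.
have [||||f hf|||B' hr hB'] := improve_along (g := x_ Bs - x_ B) (D := dmax)
    (p := (n - m)%N) (k := p) no_ray dmin_le _ _ hfB.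
- exact: ltW.
- exact: geq_minl.
- by rewrite mulmxBr !basic_solution_eq ?subrr.
- by move=> i hi; rewrite hg hi subr0.
- by rewrite hg [x_ B f 0]basic_solution_out // subr0 le_dmax.
- by rewrite hcg oppr_lt0.
- rewrite leq_min; apply/andP; split.
    have := subset_leq_card (_ : nonbasic_supp B (x_ Bs - x_ B) \subset ~: B).
    rewrite [#|~: B|]cardsCs setCK card_ord (basis_card hB); apply.
    by apply/subsetP => j; rewrite in_nonbasic_supp inE => /andP[].
  rewrite -[X in (_ <= X)%N](basis_card hbs); apply/subset_leq_card/subsetP => j.
  rewrite in_nonbasic_supp hg => /andP[hj]; rewrite [x_ B j 0]basic_solution_out // subr0.
  by apply: contraR => hj'; rewrite basic_solution_out.
exists B' => //; move: hB'; rewrite hcg opprK.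
have -> : cost (x_ B) - cost (x_ B') = gap B - gap B' by rewrite /gap; ring.
have hn : 0 < ((n - m)%N%:R : R) by rewrite ltr0n.
move=> h; rewrite mulrBl mul1r lerBrDr addrC -lerBrDr.
by rewrite /K invf_div mulrAC ler_pdivrMr ?mulr_gt0 // [X in _ <= X]mulrC.
Qed.

Lemma K_ge1 : (0 < n - m)%N -> dmin <= dmax -> 1 <= K.
Proof.
move=> hnm hd; rewrite /K ler_pdivlMr // mul1r (le_trans hd) //.
by rewrite ler_peMl ?(ltW dmax_gt0) // ler1n.
Qed.

Lemma gap_phases q B : (0 < n - m)%N -> dmin <= dmax -> feas B ->
  exists2 B', reach B (p * q) B' & gap B' <= (1 - K^-1) ^+ q * gap B.
Proof.
move=> hnm hd; have hK : 0 <= 1 - K^-1.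
  by rewrite subr_ge0 invf_le1 ?K_ge1 // (lt_le_trans ltr01) ?K_ge1.
elim: q B => [|q IH] B hB.
  by exists B; [rewrite muln0; apply: reach_refl | rewrite expr0 mul1r].
have [hg0|hg0] := leP (gap B) 0.
  exists B; first exact: reach_refl.
  have -> : gap B = 0 by apply/eqP; rewrite eq_le hg0 gap_ge0.
  by rewrite mulr0.
have [B1 hr1 h1] := gap_phase hnm hB hg0.
have [B' hr' h'] := IH B1 (reach_feasible hB hr1).
exists B'; first by rewrite mulnS; apply: reach_trans hr'.
by apply: le_trans h' _; rewrite exprSr -mulrA ler_wpM2l // exprn_ge0.
Qed.

(** The indices whose coordinate may still be nonzero: a nonzero coordinate [j] is
    at least [dmin] and so contributes at least [rc Bs 0 j * dmin] to the gap.
    Depending on the gap alone, this set can only shrink along the run. *)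
Definition unsettled B := [set j | (j \notin Bs) && (rc Bs 0 j * dmin <= gap B)].

Lemma settled_zero B0 B j : feas B -> gap B <= gap B0 -> j \notin Bs ->
  j \notin unsettled B0 -> x_ B j 0 = 0.
Proof.
move=> hB hg hj; rewrite inE hj /= -ltNge => hlt; apply/eqP.
apply: contraTT hlt => hx; rewrite -leNgt; apply: le_trans hg.
by apply: le_trans (gap_term j hB); rewrite ler_wpM2l // dmin_le.
Qed.

(** If no index is settled on the way from [B] to [B'], then each of the at most
    [m] nonzero terms of the gap of [B] is at most [dmax / dmin * gap B']. *)
Lemma unsettled_shrink B B' : feas B -> feas B' ->
  m%:R * (dmax / dmin) * gap B' < gap B ->
  (exists2 j, j \in unsettled B & j \notin unsettled B').
Proof.
move=> hfB hfB' hlt; apply/exists_inP; rewrite -[_ _ _]negbK negb_exists_in.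
apply/negP => /forall_inP hall; have [hB hx] := feasible_basisP _ _ _ hfB.
have hg' := gap_ge0 hfB'.
have hterm j : rc Bs 0 j * x_ B j 0 <= dmax / dmin * gap B'.
  have hrhs : 0 <= dmax / dmin * gap B' by rewrite mulr_ge0 // divr_ge0 // ltW.
  have [hj|hj] := boolP (j \in Bs); first by rewrite reduced_cost_basic ?mul0r.
  have [hu|hu] := boolP (j \in unsettled B); last first.
    by rewrite (settled_zero hfB (lexx _) hj hu) mulr0.
  have := hall j hu; rewrite negbK inE => /andP[_ hr].
  rewrite mulrC -mulrA; apply: (@le_trans _ _ (dmax * rc Bs 0 j)).
    by rewrite ler_wpM2r // le_dmax.
  by rewrite ler_wpM2l ?(ltW dmax_gt0) // mulrC ler_pdivlMr.
move: hlt; apply/negP; rewrite -leNgt gapE // (bigID (mem B)) /=.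
rewrite [X in _ + X]big1 ?addr0 => [|j hj]; last by rewrite basic_solution_out ?mulr0.
apply: (@le_trans _ _ (\sum_(j in B) dmax / dmin * gap B')); first exact: ler_sum.
by rewrite sumr_const (basis_card hB) -[X in X <= _]mulr_natl mulrA.
Qed.

Lemma unsettled_sub B B' : gap B' <= gap B -> unsettled B' \subset unsettled B.
Proof.
move=> h; apply/subsetP => j; rewrite !inE => /andP[-> h'].
exact: le_trans h' h.
Qed.

(** When only [j] is unsettled, the possible solutions lie on a line through
    [x_ Bs], and a vertex on it other than [x_ Bs] cannot be followed by another
    one closer to [x_ Bs].  Hence the last unsettled index costs one nondegenerate
    pivot only, and the saving pays for the final degenerate pivots. *)
Lemma last_unsettled B B' j : feas B -> feas B' -> gap B' < gap B ->
  unsettled B \subset [set j] -> gap B' = 0.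
Proof.
move=> hfB hfB' hlt hu.
have [hB hx] := feasible_basisP _ _ _ hfB.
have [hB' hx'] := feasible_basisP _ _ _ hfB'.
have hz B1 k : feas B1 -> gap B1 <= gap B -> k \notin Bs -> k != j -> x_ B1 k 0 = 0.
  move=> h1 h2 hk hkj; apply: (settled_zero h1 h2 hk).
  by apply: contra hkj => /(subsetP hu); rewrite inE.
have hgap B1 : feas B1 -> gap B1 <= gap B -> gap B1 = rc Bs 0 j * x_ B1 j 0.
  move=> h1 h2; rewrite gapE // (bigD1 j) //= big1 ?addr0 // => k hk.
  have [hkB|hkB] := boolP (k \in Bs); first by rewrite reduced_cost_basic ?mul0r.
  by rewrite hz ?mulr0.
apply/eqP; apply: contraTT hlt => hne; apply/negP => hlt.
have hg' : 0 < gap B' by rewrite lt0r hne gap_ge0.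
have eB := hgap B hfB (lexx _); have eB' := hgap B' hfB' (ltW hlt).
have hsj : 0 < rc Bs 0 j.
  by rewrite lt0r hss andbT; apply: contraTneq hg' => hs; rewrite eB' hs mul0r ltxx.
have hx'j : 0 < x_ B' j 0 by move: hg'; rewrite eB' pmulr_rgt0.
have hxj : x_ B' j 0 < x_ B j 0 by move: hlt; rewrite eB eB' ltr_pM2l.
set a := x_ B j 0 in hxj; set a' := x_ B' j 0 in hxj hx'j.
have [hjs|hjs] := boolP (j \in Bs).
  by move: hsj; rewrite reduced_cost_basic ?ltxx.
have hsub z i : (z - x_ Bs) i 0 = z i 0 - x_ Bs i 0.
  by rewrite -scaleN1r entry_addZ mulN1r.
have hw : a' *: (x_ B - x_ Bs) - a *: (x_ B' - x_ Bs) = 0.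
  apply: (basis_inj hbs).
  - move=> k hk; rewrite -scaleNr entry_addZ mxE !hsub.
    rewrite [x_ Bs k 0]basic_solution_out // !subr0.
    have [->|hkj] := eqVneq k j; first by rewrite -/a -/a'; ring.
    by rewrite !hz ?(ltW hlt) // !mulr0 addr0.
  - by move=> k _; rewrite mxE.
  - rewrite mulmxBr -!scalemxAr !mulmxBr !basic_solution_eq //.
    by rewrite !subrr !scaler0 subrr mulmx0.
(* [x_ B'] lies strictly between [x_ B] and [x_ Bs], so the direction joining
   these two is supported in the basis [B'] *)
have h0 : x_ B - x_ Bs = 0.
  apply: (basis_inj hB').
  - move=> k hk.
    have : (a' *: (x_ B - x_ Bs) - a *: (x_ B' - x_ Bs)) k 0 = 0 by rewrite hw mxE.
    rewrite -scaleNr entry_addZ mxE !hsub [x_ B' k 0]basic_solution_out //.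
    have := hx k; have := hxs k; set u := x_ B k 0; set v := x_ Bs k 0 => hv0 hu0 he.
    have : a' * u + (a - a') * v = 0 by rewrite -[RHS]he; ring.
    have haa : 0 < a - a' by rewrite subr_gt0.
    move/eqP; rewrite paddr_eq0 ?mulr_ge0 ?(ltW haa) ?(ltW hx'j) //.
    rewrite !mulf_eq0 (gt_eqF hx'j) (gt_eqF haa) /= => /andP[/eqP -> /eqP ->].
    by rewrite subrr.
  - by move=> k _; rewrite mxE.
  - by rewrite mulmxBr !basic_solution_eq // subrr mulmx0.
have : (x_ B - x_ Bs) j 0 = 0 by rewrite h0 mxE.
rewrite hsub [x_ Bs j 0]basic_solution_out // subr0 -/a => ha.
by move: (lt_trans hx'j hxj); rewrite ha ltxx.
Qed.

Lemma gap_descent q u B : (0 < n - m)%N -> dmin <= dmax ->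
  m%:R * (dmax / dmin) * (1 - K^-1) ^+ q < 1 -> feas B ->
  (#|unsettled B| <= u.+1)%N ->
  exists2 B', reach B (p * (u * q).+1) B' & gap B' = 0.
Proof.
move=> hnm hd hq; have hL : 0 <= m%:R * (dmax / dmin).
  by rewrite mulr_ge0 ?ler0n // divr_ge0 // ltW.
have hK : 0 < K by rewrite (lt_le_trans ltr01) ?K_ge1.
elim: u B => [|u IH] B hfB hu.
all: have [hg0|hg0] := leP (gap B) 0.
1,3: by exists B; [exact: reach_refl | apply/eqP; rewrite eq_le hg0 gap_ge0].
  have [B' hr hB'] := gap_phase hnm hfB hg0; exists B'; first by rewrite mul0n muln1.
  have hfB' := reach_feasible hfB hr.
  have hlt : gap B' < gap B.
    by apply: le_lt_trans hB' _; rewrite mulrBl mul1r gtrBl mulr_gt0 // invr_gt0.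
  have [j hj] : exists j, unsettled B \subset [set j].
    case: (set_0Vmem (unsettled B)) => [hu0|[j hj]].
      by exists (Ordinal (leq_trans hnm (leq_subr m n))); rewrite hu0 sub0set.
    by exists j; rewrite -(eqP (_ : [set j] == unsettled B)) // eqEcard sub1set hj cards1.
  exact: last_unsettled hlt hj.
have [B1 hr1 hB1] := gap_phases q hnm hd hfB.
have hfB1 := reach_feasible hfB hr1.
have hlt : m%:R * (dmax / dmin) * gap B1 < gap B.
  apply: le_lt_trans (ler_wpM2l hL hB1) _.
  by rewrite (mulrA (_ * _)) gtr_pMl.
have [j hj hj'] := unsettled_shrink hfB hfB1 hlt.
have hle : gap B1 <= gap B.
  apply: le_trans hB1 _; rewrite ger_pMl // exprn_ile1 //.
    by rewrite subr_ge0 invf_le1 // K_ge1.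
  by rewrite gerBl invr_ge0 ltW.
have [|B' hr' hB'] := IH B1 hfB1.
  rewrite -ltnS; apply: leq_trans hu; apply/proper_card/properP.
  by split; [apply: unsettled_sub | exists j].
exists B' => //; apply: reach_weaken (reach_trans hr1 hr').
by rewrite -mulnDr mulSn addnS.
Qed.

(** Any optimal basis of the solution [x_ B] contains its nonzero coordinates,
    which [B] contains too; since [b != 0] there is at least one, hence [m.-1]
    and not [m]. *)
Lemma gap_zero_reach B : (0 < m)%N -> b != 0 -> feas B -> gap B = 0 ->
  exists2 B', reach B (minn (n - m) m.-1) B' & optimal_basis A b c B'.
Proof.
move=> hm hb hfB hg; have [hB hx] := feasible_basisP _ _ _ hfB.
have [|d hd|j hj|B2 [hB2 hF hrc]] :=
    @dual_basis_extend R m n A c (nonzero_coords (x_ B)) (rc Bs 0) _ _ hss.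
- by exists B => //; apply: nonzero_coords_basis.
- exact: reduced_cost_ker.
- have := gap_term j hfB; rewrite hg => hle; move: hj; rewrite inE => hxj.
  have : rc Bs 0 j * x_ B j 0 = 0 by apply/eqP; rewrite eq_le hle gap_term_ge0.
  by move/eqP; rewrite mulf_eq0 (negPf hxj) orbF => /eqP.
have [hopt2 hx2] := optimal_of_nonzero_coords hfB hB2 hF hrc.
apply: optimal_approach hopt2 hx2 _ => //; rewrite leq_min; apply/andP; split.
  have -> : (n - m)%N = #|~: B2| by rewrite cardsCs setCK card_ord (basis_card hB2).
  by apply/subset_leq_card/subsetP => j; rewrite !inE => /andP[].
have [i hi] : exists i, i \in nonzero_coords (x_ B).
  apply/set0Pn; apply: contraNneq hb => h0; rewrite -(basic_solution_eq b hB).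
  suff -> : x_ B = 0 by rewrite mulmx0.
  apply/colP => i; rewrite [RHS]mxE; apply/eqP/negPn/negP => hi.
  by have := in_set0 i; rewrite -h0 inE hi.
have hiB : i \in B := subsetP (nonzero_coords_basis b hB) _ hi.
have -> : m.-1 = #|B :\ i| by rewrite -(basis_card hB) (cardsD1 i B) hiB.
apply/subset_leq_card/subsetP => j; rewrite !inE => /andP[hj ->]; rewrite andbT.
by apply: contraNneq hj => ->; apply: (subsetP hF).
Qed.

End Descent.

(** * Pivot sequences as pivot rules *)

Section ScriptedRule.
Variables (R : realType) (m n : nat).
Variables (A : 'M[R]_(m, n)) (b : 'cV[R]_m) (c : 'cV[R]_n).
Implicit Types (B : {set 'I_n}).

Lemma pivot_not_optimal B f i : is_pivot A b c B f i -> ~~ optimal_basis A b c B.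
Proof.
case/and5P=> _ hf _ _ _; apply/negP => /optimal_basisP [_ h].
by move: hf; rewrite ltNge h.
Qed.

Lemma pivot_exists B : no_descent_ray A c ->
  feasible_basis A b B -> ~~ optimal_basis A b c B ->
  exists fi, is_pivot A b c B fi.1 fi.2.
Proof.
move=> no_ray hB; rewrite negb_and hB negb_forall /= => /existsP [f].
rewrite negb_imply -ltNge => /andP[_ hf].
by have [i hi] := ratio_test no_ray hB hf; exists (f, i).
Qed.

(** The memory is the list of pivots still to be performed; wherever its head is
    not a legal pivot the rule falls back on an arbitrary legal one. *)
Lemma scripted_rule (i0 : 'I_n) (w : seq ('I_n * 'I_n)) B0 B' :
  no_descent_ray A c -> legal_run A b c B0 w B' ->
  exists r : pivot_rule A b c, simplex_basis r B0 (size w) = B'.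
Proof.
move=> no_ray hw.
pose legal B (fi : 'I_n * 'I_n) := is_pivot A b c B fi.1 fi.2.
pose dflt B := odflt (i0, i0) [pick fi | legal B fi].
pose play (s : seq ('I_n * 'I_n)) B :=
  if legal B (head (i0, i0) s) then head (i0, i0) s else dflt B.
have hplay s B : feasible_basis A b B -> ~~ optimal_basis A b c B ->
    is_pivot A b c B (play s B).1 (play s B).2.
  move=> hB hn; rewrite /play; case: ifP => // _; rewrite /dflt; case: pickP => //= hno.
  by have [fi hfi] := pivot_exists no_ray hB hn; move: (hno fi); rewrite /legal hfi.
pose r := @PivotRule R m n A b c _ w (fun s B => (play s B).1)
  (fun s B => (play s B).2) (fun s _ => behead s) hplay.
have run (v : rule_memory r) B : legal_run A b c B v B' ->
    (iter (size v) (@simplex_step _ _ _ _ _ _ r) (v, B)).2 = B'.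
  elim: v B => [|[f i] v IH] B; first by move/eqP.
  case/andP=> hp hv; rewrite [size _]/= iterSr [simplex_step _]/=.
  rewrite (negPf (pivot_not_optimal hp)) /play /legal /= hp.
  exact: IH.
by exists r; apply: run.
Qed.
End ScriptedRule.

(** * The numerical bound *)

(** Here [d] is [n - m].  Besides the [d.-1 * q + 1] groups of [minn d m] pivots,
    the final degenerate pivots amount to at most one more group, and to nothing
    when [m = 1]. *)
Lemma pivot_budget (d m q : nat) : (1 < d)%N -> (0 < m)%N -> (0 < q)%N ->
  ((1 < m)%N -> (1 < q)%N) ->
  (minn d m * (d.-1 * q).+1 + minn d m.-1 <= minn d m * d * q)%N.
Proof.
case: d => // d _; case: m => [//|m] _ hq hmq /=.
rewrite mulnS -!mulnA mulSn mulnDr addnAC leq_add2r.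
case: m hmq => [|m] hmq; first by rewrite minn0 addn0 leq_pmulr.
apply: (@leq_trans (minn d.+1 m.+2 * 2)); last by rewrite leq_mul2l hmq ?orbT.
by rewrite muln2 -addnn leq_add2l leq_min geq_minl (leq_trans (geq_minr _ _)).
Qed.

Section Rate.
Variable R : realType.
Implicit Types K L : R.

Lemma geometric_decay K L (q : nat) : 1 <= K -> 0 < L -> (0 < q)%N ->
  K * ln L <= q%:R -> L * (1 - K^-1) ^+ q < 1.
Proof.
move=> hK hL hq hle; have hK0 : 0 < K by apply: lt_le_trans hK.
have h1 : 1 - K^-1 < expR (- K^-1) by rewrite expR_gt1Dx // oppr_eq0 invr_eq0 gt_eqF.
have h0 : 0 <= 1 - K^-1 by rewrite subr_ge0 invf_le1.
have h2 : (1 - K^-1) ^+ q < expR (- K^-1) ^+ q by rewrite ltrXn2r // -lt0n.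
rewrite mulrC -ltr_pdivlMr // mul1r; apply: lt_le_trans h2 _.
rewrite -expRM_natl -[L in _ <= L^-1]lnK ?posrE // -expRN ler_expR mulrN lerN2.
by rewrite ler_pdivlMr // mulrC.
Qed.

Lemma ln2_gt : 2^-1 < ln 2 :> R.
Proof.
have h : 1 + - 2^-1 < expR (- 2^-1) :> R.
  by rewrite expR_gt1Dx // oppr_eq0 invr_eq0 pnatr_eq0.
rewrite -[ln 2]opprK -lnV ?posrE // ltrNr -ltr_expR lnK ?posrE ?invr_gt0 //.
by apply: le_lt_trans h; lra.
Qed.
End Rate.

(** * The theorem *)

Theorem theorem3 (R : realType) (m n : nat)
  (A : 'M[R]_(m, n)) (b : 'cV[R]_m) (c : 'cV[R]_n)
  (hrank : \rank A = m)
  (hopt : exists x : 'cV[R]_n, lp_optimal A b c x)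
  (dmin dmax : R)
  (hmin : is_min_coord A b dmin) (hmax : is_max_coord A b dmax)
  (hnd : ~ [/\ m = 1%N, (1 < n)%N & dmin = dmax])
  (B0 : {set 'I_n}) (hB0 : feasible_basis A b B0) :
  exists (r : pivot_rule A b c) (t : nat),
    t%:Z <= (minn (n - m) m * (n - m))%N%:Z *
            Num.ceil ((n - m)%N%:R * dmax / dmin * ln (m%:R * (dmax / dmin)))
    /\ optimal_basis A b c (simplex_basis r B0 t).
Proof.
have no_ray := optimal_no_ray hopt.
have [[Bm [i0 [hBm him hdn0]]] hle] := hmin; have [_ hge] := hmax.
have [hbm hxm] := feasible_basisP _ _ _ hBm.
have hd0 : 0 < dmin by rewrite lt0r hdn0 -him hxm.
have hdd : dmin <= dmax by apply: hge; case: hmin.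
have hD0 : 0 < dmax by apply: lt_le_trans hdd.
have dmin_le B i : feasible_basis A b B -> basic_solution A b B i 0 != 0 ->
  dmin <= basic_solution A b B i 0 by move=> h1 h2; apply: hle; exists B, i.
have le_dmax B i : feasible_basis A b B -> basic_solution A b B i 0 <= dmax.
  move=> h1; have [->|h2] := eqVneq (basic_solution A b B i 0) 0; first exact: ltW.
  by apply: hge; exists B, i.
have hi0 : i0 \in Bm.
  by apply: contraNT hdn0 => hi; rewrite -him basic_solution_out.
have hm : (0 < m)%N by rewrite -(basis_card hbm) card_gt0; apply/set0Pn; exists i0.
have hmn : (m <= n)%N by rewrite -(basis_card hbm) -[leqRHS]card_ord max_card.
have hb : b != 0.
  apply: contraNneq hdn0 => hb0; rewrite -him -(basic_solution_uniq (z := 0) hbm) ?mxE //.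
    by move=> i _; rewrite mxE.
  by rewrite mulmx0 hb0.
set K := (n - m)%N%:R * dmax / dmin; set L := m%:R * (dmax / dmin).
have hdiv : 1 <= dmax / dmin by rewrite ler_pdivlMr // mul1r.
have hmL : m%:R <= L by rewrite ler_peMr // ler0n.
have hL1 : 1 <= L by apply: le_trans hmL; rewrite ler1n.
have hK0 : 0 <= K by rewrite divr_ge0 ?mulr_ge0 ?ler0n // ltW.
have rule_of_run B' w T : legal_run A b c B0 w B' -> optimal_basis A b c B' ->
    (size w <= T)%N -> T%:Z <= (minn (n - m) m * (n - m))%N%:Z * Num.ceil (K * ln L) ->
    exists (r : pivot_rule A b c) (t : nat),
    t%:Z <= (minn (n - m) m * (n - m))%N%:Z * Num.ceil (K * ln L)
    /\ optimal_basis A b c (simplex_basis r B0 t).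
  move=> hw ho hs hT; have [r hr] := scripted_rule i0 no_ray hw.
  by exists r, (size w); rewrite hr; split=> //; apply: le_trans hT; rewrite lez_nat.
have hX0 : 0 <= K * ln L by rewrite mulr_ge0 // ln_ge0.
have hc0 : 0 <= Num.ceil (K * ln L).
  by rewrite ceil_ge0; apply: lt_le_trans hX0; rewrite ltrN10.
have [ho|hno] := boolP (optimal_basis A b c B0).
  by apply: (rule_of_run B0 [::] 0%N) => //=; apply: mulr_ge0.
have hnm : (0 < n - m)%N.
  rewrite subn_gt0 ltn_neqAle hmn andbT; apply: contraNneq hno => hmn'.
  apply/andP; split=> //; apply/forallP => f; rewrite (_ : f \in B0) //.
  have [hb0 _] := feasible_basisP _ _ _ hB0.
  suff -> : B0 = setT by rewrite inE.
  by apply/eqP; rewrite eqEcard subsetT cardsT card_ord (basis_card hb0) hmn' leqnn.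
have hK1 : 1 <= K by apply: K_ge1.
(* This is where the excluded case would fail: a positive logarithm makes [q]
   positive, which [geometric_decay] needs to be strict. *)
have hLgt : 1 < L.
  move: hm; rewrite leq_eqVlt => /orP[/eqP hm1|hm1]; last first.
    by apply: lt_le_trans hmL; rewrite ltr1n.
  rewrite /L -hm1 mul1r ltr_pdivlMr // mul1r lt_neqAle hdd andbT.
  by apply/eqP => hdq; apply: hnd; split=> //; move: hnm; rewrite subn_gt0 -hm1.
have hXgt : 0 < K * ln L by rewrite mulr_gt0 ?ln_gt0 // (lt_le_trans ltr01).
pose q := `|Num.ceil (K * ln L)|%N.
have hqE : Num.ceil (K * ln L) = q%:Z by rewrite /q gez0_abs.
have hq0 : (0 < q)%N by rewrite -ltz_nat -hqE ceil_gt0.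
have hXq : K * ln L <= q%:R by rewrite (le_trans (ceil_ge _)) // hqE.
have [hnm1|hnm2] := leqP (n - m) 1.
  have [[f i] hpiv] := pivot_exists no_ray hB0 hno.
  apply: (rule_of_run (exchange B0 f i) [:: (f, i)] 1%N) => //=.
  - by rewrite hpiv eqxx.
  - by apply: single_nonbasic_pivot hpiv => //; move: hnm1; rewrite leq_subLR addn1.
  - by rewrite hqE -PoszM lez_nat !muln_gt0 leq_min hnm hm hq0.
have [Bs hBs] := exists_optimal_basis no_ray hd0 dmin_le hB0.
have hu : (#|unsettled A b c dmin Bs B0| <= (n - m).-1.+1)%N.
  rewrite prednK //.
  have hbs : is_basis A Bs by case/optimal_basisP: hBs => /feasible_basisP[].
  have -> : (n - m)%N = #|~: Bs| by rewrite cardsCs setCK card_ord (basis_card hbs).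
  by apply/subset_leq_card/subsetP => j; rewrite !inE => /andP[].
have hdecay := geometric_decay hK1 (lt_trans ltr01 hLgt) hq0 hXq.
have [B1 hr1 hg1] := gap_descent no_ray hd0 dmin_le le_dmax hBs hD0 hnm hdd hdecay hB0 hu.
have hfB1 := reach_feasible hB0 hr1.
have [B2 hr2 hB2] := gap_zero_reach hBs hm hb hfB1 hg1.
have [w hw hrun] := reach_trans hr1 hr2.
apply: (rule_of_run _ _ _ hrun hB2 hw).
rewrite hqE -PoszM lez_nat; apply: pivot_budget => // hm2.
rewrite -ltz_nat -hqE ceil_gt_int.
apply: (@lt_le_trans _ _ (2 * ln 2)).
  by have := ln2_gt R; lra.
have hln2 : 0 <= ln 2 :> R by rewrite ln_ge0 ?ler1n.
have hL2 : 2 <= L by apply: le_trans hmL; rewrite ler_nat.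
apply: ler_pM => //; last by rewrite ler_ln ?posrE // (lt_trans ltr01).
rewrite /K -mulrA -[2]mulr1; apply: ler_pM => //.
by rewrite ler_nat.
Qed.
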